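(* Let $S \in GL_n(\mathbb{R})$ be a Perron similarity. If some row of $S$ is $e^\top$, where $e \in \mathbb{R}^n$ is the all-ones vector, then $\mathcal{C}(S) \subseteq \mathcal{C}_r(S)$.
   Context: All inequalities between matrices or vectors are entrywise. A matrix $S \in GL_n(\mathbb{R})$ is called a Perron similarity if there is a real, diagonal, nonscalar matrix $D$ (i.e. $D$ is not a scalar multiple of the identity) such that $S D S^{-1} \geq 0$. For $x \in \mathbb{R}^n$, $\operatorname{diag}(x)$ denotes the diagonal matrix with diagonal entries the entries of $x$. The spectracone of $S$ is $\mathcal{C}(S) := \{x \in \mathbb{R}^n : S \operatorname{diag}(x) S^{-1} \geq 0\}$. The row cone $\mathcal{C}_r(S)$ is the convex cone generated by the rows of $S$, i.e. the set of all linear combinations of the rows of $S$ with nonnegative coefficients. Row vectors and column vectors of length $n$ are identified when comparing $\mathcal{C}_r(S)$ and $\mathcal{C}(S)$ as subsets of $\mathbb{R}^n$. *)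

(* Defs.v *)
From mathcomp Require Import all_boot all_order all_algebra.
From mathcomp Require Import boolp classical_sets reals.

Set Implicit Arguments.
Unset Strict Implicit.
Unset Printing Implicit Defensive.

Import Order.TTheory GRing.Theory Num.Theory.

Local Open Scope ring_scope.
Local Open Scope classical_set_scope.

Definition mx_nonneg (R : realType) (m n : nat) (A : 'M[R]_(m, n)) : Prop :=
  forall i j, 0 <= A i j.

Definition perron_similarity (R : realType) (n : nat) (S : 'M[R]_n) : Prop :=
  S \in unitmx /\
  exists D : 'M[R]_n,
    [/\ is_diag_mx D, ~~ is_scalar_mx D & mx_nonneg (S *m D *m invmx S)].

(* Vectors of R^n are row vectors throughout, so that the spectracone and the
   row cone are sets in the same space. Since invmx S = S for singular S,
   spectracone S has its usual meaning only for invertible S. *)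
Definition spectracone (R : realType) (n : nat) (S : 'M[R]_n) : set 'rV[R]_n :=
  [set x | mx_nonneg (S *m diag_mx x *m invmx S)].

Definition row_cone (R : realType) (n : nat) (S : 'M[R]_n) : set 'rV[R]_n :=
  [set x | exists c : 'I_n -> R,
     (forall i, 0 <= c i) /\ x = \sum_(i < n) c i *: row i S].

(* Main.v *)
(* If row i of S is e^T and A = S diag(x) S^-1, then x^T = e^T diag(x) is row i
   of S diag(x) = A S, i.e. the combination of the rows of S whose coefficients
   are row i of A. *)
Require Import Defs.
From mathcomp Require Import all_boot all_order all_algebra.
From mathcomp Require Import boolp classical_sets reals.

Local Open Scope ring_scope.
Local Open Scope classical_set_scope.

Theorem theorem3p2 (R : realType) (n : nat) (S : 'M[R]_n)
  (hS : perron_similarity S)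
  (he : exists i : 'I_n, row i S = const_mx 1) :
  spectracone S `<=` row_cone S.
Proof.
case: hS he => Su _ [i Si] x A_ge0.
set A := S *m diag_mx x *m invmx S in A_ge0.
(* The coefficients are row [i] of [A], where row [i] of [S] is all ones; [A_ge0] makes them
   nonnegative. *)
exists (A i); split=> //.
(* Invertibility [Su] enters here: it cancels [invmx S] against [S]. *)
have AS : A *m S = S *m diag_mx x by rewrite /A mulmxKV.
(* Right multiplication by [diag_mx x] scales column [j] by the [j]-th entry of [x], so it turns the
   all-ones row into [x] itself. *)
have -> : x = row i (A *m S).
  rewrite AS row_mul Si; apply/rowP => j.
  by rewrite mul_mx_diag !mxE GRing.mul1r.
(* Row [i] of [A *m S] combines the rows of [S] with weights [A i k]. *)
by rewrite row_mul mulmx_sum_row; apply: eq_bigr => k _; rewrite mxE.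
Qed.
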